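(* Let $X$ be an infinite set and let $G$ be a group such that $\operatorname{Sym}_\omega(X)\leq G\leq \operatorname{Sym}(X)$. Then for $n\in\mathbb{N}$ the following dichotomy holds: (i) if $n\geq 4$, then $\mathfrak{Z}_n^{\pm}(G)$ is the topology of pointwise convergence on $G$ and thus is totally disconnected; (ii) if $n\leq 3$, then $\mathfrak{Z}_n^{\pm}(G)$ is hyperconnected.
   Context: $\mathbb{N}=\{0,1,2,\ldots\}$. $\operatorname{Sym}(X)$ is the symmetric group on $X$ (all permutations of $X$, composed from left to right), and $\operatorname{Sym}_\omega(X)$ is its subgroup of permutations with finite support. Functions are written on the right of their arguments. The topology of pointwise convergence on $G\leq\operatorname{Sym}(X)$ is the subspace topology inherited from the product space $X^X$, where each copy of $X$ is discrete; equivalently it has as a subbase the sets $\{f\in G:(x)f=y\}$, $x,y\in X$. A topological space (or its topology) is hyperconnected if the intersection of any two nonempty open subsets is nonempty. For a group $G$, a function $f:G\to G$ is a group polynomial of degree $n$ if $(x)f=a_0x^{\varepsilon_1}a_1\cdots x^{\varepsilon_n}a_n$ for some $a_0,\ldots,a_n\in G$ and $\varepsilon_1,\ldots,\varepsilon_n\in\{-1,1\}$; constant functions are group polynomials of degree $0$. For $n\in\mathbb{N}$, $\mathfrak{Z}^{\pm}_n(G)$ is the topology on $G$ generated (as a subbase) by the sets $\{x\in G:(x)f\neq 1_G\}$, where $f$ is a group polynomial of degree at most $n$. *)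

(* Defs.v *)
From HB Require Import structures.
From mathcomp Require Import all_boot.
From mathcomp Require Import all_classical.
From mathcomp Require Import topology.

Set Implicit Arguments.
Unset Strict Implicit.
Unset Printing Implicit Defensive.

Local Open Scope classical_set_scope.
Local Open Scope group_scope.

Record Sym (X : choiceType) := MkSym {
  sym_fun :> X -> X;
  _ : `[< bijective sym_fun >] }.

HB.instance Definition _ (X : choiceType) := [isSub for @sym_fun X].
HB.instance Definition _ (X : choiceType) := [Choice of Sym X by <:].

Section SymGroup.
Context (X : choiceType).
Implicit Types s t : Sym X.

Lemma sym_bij s : bijective s.
Proof. exact/asboolP/(valP s). Qed.

Lemma symP s t : s =1 t -> s = t.
Proof. by move=> /funext; exact: val_inj. Qed.

Lemma sym_inv_exists s : exists g, cancel s g /\ cancel g s.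
Proof. by case: (sym_bij s) => g; exists g. Qed.

Definition sym_inv_fun s : X -> X := sval (cid (sym_inv_exists s)).

Lemma sym_invK s : cancel s (sym_inv_fun s).
Proof. exact: (svalP (cid (sym_inv_exists s))).1. Qed.

Lemma sym_invKV s : cancel (sym_inv_fun s) s.
Proof. exact: (svalP (cid (sym_inv_exists s))).2. Qed.

Definition sym_one : Sym X :=
  MkSym (asboolT (Bijective (fun=> erefl) (fun=> erefl) : bijective (@id X))).

(* Permutations act on the right: s * t applies s first. *)
Definition sym_mul s t : Sym X :=
  MkSym (asboolT (bij_comp (sym_bij t) (sym_bij s))).

Definition sym_inv s : Sym X :=
  MkSym (asboolT (Bijective (@sym_invKV s) (@sym_invK s))).

Lemma sym_mulA : associative sym_mul.
Proof. by move=> s t u; exact: symP. Qed.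

Lemma sym_mul1 : left_id sym_one sym_mul.
Proof. by move=> s; exact: symP. Qed.

Lemma sym_mulr1 : right_id sym_one sym_mul.
Proof. by move=> s; exact: symP. Qed.

Lemma sym_mulV : left_inverse sym_one sym_inv sym_mul.
Proof. by move=> s; apply: symP => x /=; exact: sym_invKV. Qed.

Lemma sym_mulrV : right_inverse sym_one sym_inv sym_mul.
Proof. by move=> s; apply: symP => x /=; exact: sym_invK. Qed.

HB.instance Definition _ := isGroup.Build (Sym X)
  sym_mulA sym_mul1 sym_mulr1 sym_mulV sym_mulrV.

Definition Sym_fin : set (Sym X) := [set s | finite_set [set x | s x != x]].

End SymGroup.

Arguments Sym_fin : clear implicits.

Definition subgroup (T : groupType) (G : groupClosed T) : Type :=
  {x : T | x \in (G : {pred T})}.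

Section Subgroup.
Context (T : groupType) (G : groupClosed T).

HB.instance Definition _ := SubChoice.on (subgroup G).

Lemma subgroup_closed : group_closed (G : {pred T}).
Proof. by split; [exact: gpred1 | exact: gpredF]. Qed.

HB.instance Definition _ :=
  SubChoice_isSubGroup.Build T _ (subgroup G) subgroup_closed.

End Subgroup.

(* f x = a_0 x^{e_1} a_1 ... x^{e_n} a_n, where the sign e i = true stands
   for the exponent -1 and lift ord0 i is the index i + 1. *)
Definition group_polynomial (G : groupType) (n : nat) (f : G -> G) : Prop :=
  exists (a : 'I_n.+1 -> G) (e : 'I_n -> bool), forall x,
    f x = a ord0 * \prod_(i < n) ((if e i then x^-1 else x) * a (lift ord0 i)).

Definition zariski_subbase (n : nat) (G : groupType) : set (set G) :=
  [set U | exists (m : nat) (f : G -> G),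
     [/\ (m <= n)%N, group_polynomial m f & U = [set x | f x != 1]]].

Definition zariski (n : nat) (G : groupType) : Type := G.

HB.instance Definition _ (n : nat) (G : groupType) := Group.on (zariski n G).
HB.instance Definition _ (n : nat) (G : groupType) :=
  isSubBaseTopological.Build (zariski n G) (@zariski_subbase n G) id.

Definition pointwise_val (X : choiceType) (G : groupClosed (Sym X))
    (g : subgroup G) : {ptws X -> discrete_topology X} := val g.

Definition pointwise (X : choiceType) (G : groupClosed (Sym X)) : Type :=
  initial_topology (@pointwise_val X G).

HB.instance Definition _ (X : choiceType) (G : groupClosed (Sym X)) :=
  Topological.on (pointwise G).

Definition hyperconnected (T : topologicalType) : Prop :=
  forall U V : set T, open U -> open V -> U !=set0 -> V !=set0 ->
    U `&` V !=set0.

Definition open_sets (T : topologicalType) : set (set T) := [set U | open U].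

Arguments open_sets : clear implicits.

(* Main.v *)
Require Import Defs.
From HB Require Import structures.
From mathcomp Require Import all_boot.
From mathcomp Require Import all_classical.
From mathcomp Require Import topology.

(** Let [T] be the group, acting on the infinite set [X] and containing all
finitary permutations.

Degree at least four.  Every polynomial map is continuous for pointwise
convergence, because the value of a word at a point depends on finitely many
values of the variable ([poly_local]); so its topology is coarser.  For the
converse it suffices that each set of the [h] that send [u] to a given point is
open ([eval_open]).  The word saying that the transposition (x t) does not
commute with the conjugate (u v)^h = (uh vh) is a commutator, of degree 4 in
[h], and it can only be nontrivial if {x, t} meets {uh, vh}.  Asking this for
three values of [t] forces [x] to lie in {uh, vh}, and asking that for two
values of [v] forces uh = x.

Degree at most three.  Hyperconnectedness says that finitely many sets
{f <> 1}, each of them nonempty, have a common point.  The point is built by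
finite approximation: a finite partial injection of [X] always extends to a
finitary permutation ([realize]).  Up to inversion and cyclic rotation, the
nonconstant words of degree at most three are the positive words
g a g b ... g c, the words g a g^-1 b g c, and the conjugations g^-1 b g c.  For
the first two kinds, any finite partial injection can be prolonged so as to
force f <> 1: one follows the orbit of a fresh point through the word, choosing
fresh values along the way ([generic_pos_word], [generic_mixed]).
Conjugations do not have this property, since g^-1 b g is determined by finitely
many values of g when b is finitary; but with b <> 1 they can be dealt with all
at once at the very beginning, by sending a finite set that meets each support
to points in general position ([forces_conj]). *)

Local Open Scope classical_set_scope.

Set Implicit Arguments.
Unset Strict Implicit.
Unset Printing Implicit Defensive.

(** * The action on points, and transpositions *)

Section PermutationGroup.
Local Open Scope group_scope.
Context (X : choiceType) (G : groupClosed (Sym X)).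
Local Notation T := (subgroup G).
Implicit Types (g h a b c : T) (x y u v w : X) (p q : seq (X * X)).

Definition act g x : X := (val g : Sym X) x.

Lemma actM g h x : act (g * h) x = act h (act g x).
Proof. by []. Qed.

Lemma act1 x : act 1 x = x.
Proof. by []. Qed.

Lemma actK g : cancel (act g) (act g^-1).
Proof. by move=> x; rewrite -actM mulgV act1. Qed.

Lemma actKV g : cancel (act g^-1) (act g).
Proof. by move=> x; rewrite -actM mulVg act1. Qed.

Lemma act_inj g : injective (act g).
Proof. exact: can_inj (actK g). Qed.

Lemma act_ext g h : act g =1 act h -> g = h.
Proof. by move=> gh; apply: val_inj; apply: symP. Qed.

Lemma act_moves g : g <> 1 -> exists x, act g x <> x.
Proof.
by move=> g1; apply: contrapT => /forallNP gx; apply: g1; apply: act_ext => x;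
  apply: contrapT; exact: gx.
Qed.

Context (infX : infinite_set [set: X]).
Context (finG : Sym_fin X `<=` [set s | s \in (G : {pred Sym X})]).

Lemma fresh (L : seq X) : exists x, x \notin L.
Proof.
apply: contrapT => /forallNP xL; apply: infX.
apply: (@sub_finite_set _ _ [set` L]); last exact: finite_seq.
by move=> x _ /=; apply/negPn/negP; exact: xL.
Qed.

Lemma fresh_act a (L M : seq X) : exists x, x \notin L /\ act a x \notin M.
Proof.
have [x] := fresh (L ++ [seq act a^-1 y | y <- M]).
rewrite mem_cat negb_or => /andP[xL xM]; exists x; split=> //.
by apply: contra xM => /(map_f (act a^-1)); rewrite actK.
Qed.

Definition swap y z x : X := if x == y then z else if x == z then y else x.

Lemma swapK y z : involutive (swap y z).
Proof.
move=> x; rewrite /swap; have [->|xy] := eqVneq x y.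
  by rewrite eqxx; case: eqVneq => // ->.
have [->|xz] := eqVneq x z; first by rewrite eqxx.
by rewrite (negbTE xy) (negbTE xz).
Qed.

Definition swap_sym y z : Sym X :=
  MkSym (asboolT (Bijective (swapK y z) (swapK y z))).

Lemma swap_sym_in y z : swap_sym y z \in (G : {pred Sym X}).
Proof.
apply: finG; apply: (@sub_finite_set _ _ [set` [:: y; z]]); last exact: finite_seq.
move=> x /=; rewrite /swap !inE.
by case: (x =P y) => //= _; case: (x =P z) => //= _; rewrite eqxx.
Qed.

Definition tr y z : T := Sub (swap_sym y z) (swap_sym_in y z).

Lemma trE y z x : act (tr y z) x = swap y z x.
Proof. by rewrite /act SubK. Qed.

Lemma tr_sqr y z : tr y z * tr y z = 1.
Proof. by apply: act_ext => x; rewrite actM !trE swapK. Qed.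

Lemma tr_conj u v g : g^-1 * tr u v * g = tr (act g u) (act g v).
Proof.
apply: act_ext => x; rewrite -[x](actKV g); move: (act g^-1 x) => y.
rewrite !actM actK !trE /swap !(inj_eq (@act_inj g)).
by case: ifP => // _; case: ifP.
Qed.

Lemma tr_disjoint x z u v : u \notin [:: x; z] -> v \notin [:: x; z] ->
  tr x z * tr u v = tr u v * tr x z.
Proof.
rewrite !inE !negb_or => /andP[ux uz] /andP[vx vz].
apply: act_ext => t; rewrite !actM !trE /swap.
have [xu xv zu zv] : [/\ x == u = false, x == v = false, z == u = false
    & z == v = false].
  by rewrite !(eq_sym x) !(eq_sym z) !(negPf ux, negPf uz, negPf vx, negPf vz).
have [->|tx] := eqVneq t x; first by rewrite zu zv xu xv eqxx.
have [tz|tz] := eqVneq t z.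
  by rewrite xu xv tz zu zv -tz (negPf tx) tz eqxx.
have [tu|tu] := eqVneq t u; first by rewrite (negPf vx) (negPf vz).
have [tv|tv] := eqVneq t v; first by rewrite (negPf ux) (negPf uz).
by rewrite (negPf tx) (negPf tz).
Qed.

Lemma tr_meet x z w : x != z -> w \notin [:: x; z] ->
  tr x z * tr x w <> tr x w * tr x z.
Proof.
rewrite !inE !negb_or => xz /andP[wx wz] /(congr1 (act^~ z)).
rewrite !actM !trE /swap (eq_sym z x) (eq_sym z w) (negPf xz) (negPf wz) !eqxx.
by rewrite (eq_sym z x) (negPf xz) => /eqP; rewrite (negPf wx).
Qed.

(** * Finite approximations of a permutation *)

(** A finite partial injection is encoded by its graph, a list of pairs without
repetition among the sources nor among the targets. *)
Definition partial_inj p := uniq (unzip1 p) && uniq (unzip2 p).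

Definition extends p g := all (fun xy => act g xy.1 == xy.2) p.

(** Some finite prolongation of [p] decides membership in [U] positively: every
group element that agrees with it lies in [U]. *)
Definition forces p (U : set T) :=
  exists2 q, partial_inj (q ++ p) & forall g, extends (q ++ p) g -> U g.

(** For the topology of pointwise convergence, this amounts to containing a dense
open set. *)
Definition generic (U : set T) := forall p, partial_inj p -> forces p U.

Lemma partial_inj_cons y v p :
  partial_inj p -> y \notin unzip1 p -> v \notin unzip2 p -> partial_inj ((y, v) :: p).
Proof. by rewrite /partial_inj /= => /andP[-> ->] -> ->. Qed.

Lemma forces_now p (U : set T) :
  partial_inj p -> (forall g, extends p g -> U g) -> forces p U.
Proof. by move=> pp pU; exists [::]. Qed.

(** One step of a construction: once the value [v] at [y] is chosen, it may be
used in the rest of the argument. *)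
Lemma forces_cons y v p (U V : set T) : forces ((y, v) :: p) U ->
  (forall g, extends ((y, v) :: p) g -> U g -> V g) -> forces p V.
Proof.
move=> [q]; rewrite -cat_rcons => qp qU UV; exists (rcons q (y, v)) => // g eg.
apply: UV; last exact: qU.
by move: eg; rewrite cat_rcons /extends all_cat => /andP[].
Qed.

Lemma generic_sub (U V : set T) : U `<=` V -> generic U -> generic V.
Proof. by move=> UV gU p /gU[q qp qU]; exists q => // g /qU/UV. Qed.

(** Prescribing one more value only requires to compose with the transposition
of the present value and the wanted one, which moves none of the other
prescribed values. *)
Lemma realize p : partial_inj p -> exists g, extends p g.
Proof.
elim: p => [|[x y] p IH]; first by exists 1.
rewrite /partial_inj /= => /andP[/andP[xp up1] /andP[yp up2]].
have [|g eg] := IH; first by rewrite /partial_inj up1.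
exists (g * tr (act g x) y); rewrite /extends /= actM trE /swap eqxx eqxx /=.
apply/allP => z zp; have gz := eqP (allP eg z zp).
rewrite actM trE /swap (inj_eq (@act_inj g)) gz.
case: ifP => [/eqP zx|_]; first by move: xp; rewrite -zx map_f.
by case: ifP => [/eqP zy|//]; move: yp; rewrite -zy map_f.
Qed.

(** * Words whose nontriviality can always be forced *)

Definition pos_word (s : seq T) g := foldr (fun a t => g * (a * t)) 1 s.

(** The orbit of [y] is followed through the word: the value at each new point is
chosen so that the next point is outside of the domain, and the last value is
chosen so as to miss [y0]. *)
Lemma forces_pos_word s p y y0 : s != [::] -> partial_inj p -> y \notin unzip1 p ->
  forces p [set g | act (pos_word s g) y <> y0].
Proof.
elim: s p y => // a s IH p y _ pp yp.
have [v [vp avp]] := fresh_act a (unzip2 p) [:: y0, y & unzip1 p].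
have pp1 := partial_inj_cons pp yp vp.
move: avp; rewrite !inE !negb_or => /and3P[/eqP avy0 avy avp].
have posE g : extends ((y, v) :: p) g ->
    act (pos_word (a :: s) g) y = act (pos_word s g) (act a v).
  by move=> /andP[/eqP /= gy _]; rewrite !actM gy.
have [s0|s0] := eqVneq s [::].
  by apply: (forces_cons (forces_now pp1 (fun _ => id))) => g eg _ /=;
    rewrite posE // s0.
apply: (forces_cons (IH _ (act a v) s0 pp1 _)) => [|g eg]; last by rewrite /= posE.
by rewrite inE negb_or avy.
Qed.

Lemma generic_pos_word s : s != [::] -> generic [set g | pos_word s g <> 1].
Proof.
move=> s0 p pp; have [y yp] := fresh (unzip1 p).
have [q qp qU] := forces_pos_word y s0 pp yp.
by exists q => // g /qU /= gy /(congr1 (act^~ y)).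
Qed.

(** With [v] the value at [y] and [t] the preimage of [act a v], the word sends
[y] to [act c (act g (act b t))].  The points are fresh except for two
coincidences: if [a] fixes [v] then [t] is [y], and if [b] fixes [t] then the
last value taken by [g] is [act a v] again. *)
Lemma generic_mixed a b c :
  generic [set g | g * a * g^-1 * b * g * c <> 1].
Proof.
move=> p pp.
suff [y [yp yU]] : exists y, y \notin unzip1 p /\
    forces p [set g | act (g * a * g^-1 * b * g * c) y <> y].
  by have [q qp qU] := yU; exists q => // g /qU /= gy /(congr1 (act^~ y)).
have [y [yp byp]] := fresh_act b (unzip1 p) (unzip1 p).
have [v [vp]] := fresh_act a (unzip2 p) (act c^-1 y :: unzip2 p).
rewrite inE negb_or => /andP[/eqP avy avp].
have cavy : act c (act a v) <> y by move=> /(congr1 (act c^-1)); rewrite actK.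
exists y; split=> //.
(* From the moment when the preimage t is known, a single value is left to
   choose, and none at all if b fixes t. *)
have finish p' t : partial_inj p' -> act b t = t \/ act b t \notin unzip1 p' ->
    (forall g, extends p' g -> act g y = v /\ act g t = act a v) ->
    forces p' [set g | act (g * a * g^-1 * b * g * c) y <> y].
  move=> pp' bt gE.
  have wordE g : extends p' g ->
      act (g * a * g^-1 * b * g * c) y = act c (act g (act b t)).
    by move=> /gE[gy gt]; rewrite !actM gy -gt actK.
  case: bt => [bt|bt].
    apply: forces_now => // g eg /=; rewrite wordE // bt.
    by have [_ ->] := gE g eg.
  have [w [wp cwy]] := fresh_act c (unzip2 p') [:: y].
  apply: (forces_cons (forces_now (partial_inj_cons pp' bt wp) (fun _ => id))).
  move=> g /andP[/eqP /= gbt eg] _ /=; rewrite wordE // gbt.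
  by apply/eqP; move: cwy; rewrite inE.
have pp1 := partial_inj_cons pp yp vp.
have [av|av] := eqVneq (act a v) v.
  apply: (forces_cons (finish ((y, v) :: p) y pp1 _ _)) => [|g|//].
    by have [->|by'] := eqVneq (act b y) y; [left|right; rewrite inE negb_or by'].
  by rewrite av => /andP[/eqP].
have [t [typ btp]] := fresh_act b (y :: unzip1 p) (y :: unzip1 p).
have pp2 : partial_inj [:: (t, act a v), (y, v) & p].
  by apply: partial_inj_cons => //; rewrite inE negb_or av.
apply: (@forces_cons y v) => [|g _]; last by apply.
apply: (forces_cons (finish _ t pp2 _ _)) => [|g|//].
  by have [->|bt] := eqVneq (act b t) t; [left|right; rewrite inE negb_or bt].
by move=> /and3P[/eqP ? /eqP].
Qed.

(** * Conjugation constraints *)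

(** Each new value has to avoid the images of the previous ones under the elements
of [D] and their inverses, which excludes finitely many points. *)
Lemma spread (D : seq T) (F : seq X) : uniq F -> exists p,
  [/\ partial_inj p, unzip1 p = F & {in p &, forall z1 z2, z1.1 != z2.1 ->
    {in D, forall c, act c z1.2 != z2.2}}].
Proof.
elim: F => [|x F IH] /=; first by exists [::].
move=> /andP[xF /IH[p [pp pF pD]]].
have [v] := fresh (unzip2 p ++ [seq act c w | c <- D, w <- unzip2 p]
                   ++ [seq act c^-1 w | c <- D, w <- unzip2 p]).
rewrite !mem_cat !negb_or => /and3P[vp vD vDV].
exists ((x, v) :: p); split; first by apply: partial_inj_cons; rewrite ?pF.
  by rewrite /= pF.
have unz2 (z : X * X) : z \in p -> z.2 \in unzip2 p by exact: map_f.
move=> z1 z2; rewrite !inE => /predU1P[->|z1p] /predU1P[->|z2p]; first by rewrite eqxx.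
- move=> _ c cD /=; apply: contra vDV => /eqP /(congr1 (act c^-1)); rewrite actK => ->.
  by apply: (@allpairs_f _ _ _ (fun c w => act c^-1 w)) => //; exact: unz2.
- move=> _ c cD /=; apply: contra vD => /eqP <-.
  by apply: (@allpairs_f _ _ _ act) => //; exact: unz2.
- exact: pD.
Qed.

(** If [d.1] moves [x], and [d.2] does not send the value of [g] at [x] to
its value at [act d.1 x], then the conjugate of [d.1] by [g] differs from [d.2].
So it is enough to prescribe [g] on one such pair of points for each [d]. *)
Lemma forces_conj (C : seq (T * T)) : {in C, forall d, d.1 <> 1} ->
  exists2 p, partial_inj p & forall g, extends p g ->
    {in C, forall d, g^-1 * d.1 * g <> d.2}.
Proof.
move=> C1.
have [F FC] : exists F : seq X, {in C, forall d, exists x,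
    [/\ x \in F, act d.1 x \in F & act d.1 x != x]}.
  elim: C C1 => [|d C IH] C1; first by exists [::].
  have [|F FC] := IH; first by move=> e eC; apply: C1; rewrite inE eC orbT.
  have [x /eqP dx] := act_moves (C1 d (mem_head _ _)).
  exists [:: x, act d.1 x & F] => e; rewrite inE => /predU1P[->|/FC[y [yF eyF ey]]].
    by exists x; rewrite !inE !eqxx orbT.
  by exists y; rewrite !inE yF eyF !orbT.
have [p [pp pF pC]] := spread (unzip2 C) (undup_uniq F).
exists p => // g /allP eg d dC /(congr1 (act^~ _)) e.
have [x [xF dxF dx]] := FC d dC.
have inp z : z \in F -> exists2 t, t \in p & z = t.1.
  by rewrite -mem_undup -pF => /mapP.
have [z1 z1p xE] := inp x xF; have [z2 z2p dxE] := inp _ dxF.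
have z12 : z1.1 != z2.1 by rewrite -xE -dxE eq_sym.
have /eqP := pC z1 z2 z1p z2p z12 d.2 (map_f _ dC); apply.
rewrite -(eqP (eg _ z1p)) -(eqP (eg _ z2p)) -xE -dxE.
by rewrite -e !actM actK.
Qed.

(** All that is needed about a nonempty set {f <> 1} with f of degree at most
three: it is generic, or it is implied by a conjugation constraint. *)
Definition tame (U : set T) :=
  generic U \/ exists b c, b <> 1 /\ forall g, g^-1 * b * g <> c -> U g.

(** The conjugation constraints [C] must be satisfied first, because unlike
generic sets they cannot be forced above an arbitrary partial injection. *)
Lemma tame_meet (L : seq (set T)) : {in L, forall U, tame U} ->
  exists g, {in L, forall U : set T, U g}.
Proof.
move=> tL.
suff [C [C1 CL]] : exists C : seq (T * T), {in C, forall d, d.1 <> 1} /\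
    forall p, partial_inj p ->
      (forall g, extends p g -> {in C, forall d, g^-1 * d.1 * g <> d.2}) ->
      forces p [set g | {in L, forall U : set T, U g}].
  have [p pp pC] := forces_conj C1.
  have [q qp qL] := CL p pp pC.
  by have [g /qL] := realize qp; exists g.
elim: L tL => [|U L IH] tL.
  by exists [::]; split=> // p pp _; apply: forces_now.
have [|C [C1 CL]] := IH; first by move=> V VL; apply: tL; rewrite inE VL orbT.
have [gU|[b [c [b1 bcU]]]] := tL U (mem_head _ _).
  exists C; split=> // p pp /(CL p pp)[q qp qL].
  have [r rqp rU] := gU _ qp; exists (r ++ q); rewrite -catA // => g eg V.
  rewrite inE => /predU1P[->|]; first exact: rU.
  by apply: qL; move: eg; rewrite /extends all_cat => /andP[].
exists ((b, c) :: C); split=> [d|p pp pC].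
  by rewrite inE => /predU1P[->//|]; exact: C1.
have [|q qp qL] := CL p pp.
  by move=> g /pC gC d dC; apply: gC; rewrite inE dC orbT.
exists q => // g eg V; rewrite inE => /predU1P[->|]; last exact: qL.
apply: bcU; apply: (pC g _ (b, c)); last exact: mem_head.
by move: eg; rewrite /extends all_cat => /andP[].
Qed.

(** * Polynomials of degree at most three *)

Lemma mul1C g h : g * h = 1 -> h * g = 1.
Proof. by move=> /mulg1_eq <-; rewrite mulVg. Qed.

Lemma tame_sub (U V : set T) : U `<=` V -> tame U -> tame V.
Proof.
move=> UV [gU|[b [c [b1 bcU]]]]; first by left; exact: generic_sub gU.
by right; exists b, c; split=> // g /bcU/UV.
Qed.

Lemma tame_setT : tame setT.
Proof. by left=> p pp; exact: forces_now. Qed.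

(** For [b = 1] the word is constant. *)
Lemma tame_conj b c : (exists g, g^-1 * b * g * c <> 1) ->
  tame [set g | g^-1 * b * g * c <> 1].
Proof.
have [->|b1] := pselect (b = 1).
  case=> g; rewrite mulg1 mulVg mul1g => c1; apply: tame_sub tame_setT => h _ /=.
  by rewrite mulg1 mulVg mul1g.
move=> _; right; exists b, c^-1; split=> // g bc; apply: contra_not bc => e.
by rewrite -[RHS]mul1g -e mulgK.
Qed.

Lemma tame_pos_word s : s != [::] -> tame [set g | pos_word s g <> 1].
Proof. by left; exact: generic_pos_word. Qed.

Lemma tame_mixed a b c : tame [set g | g * a * g^-1 * b * g * c <> 1].
Proof. by left; exact: generic_mixed. Qed.

(** The equation f(g) = 1 is invariant under inversion and conjugation of the
word, hence under cyclic rotation.  Each sign pattern is thereby reduced to one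
of [tame_pos_word], [tame_mixed] and [tame_conj]. *)
Lemma cubic_tame m (f : T -> T) : (m <= 3)%N -> group_polynomial m f ->
  (exists g, f g != 1) -> tame [set g | f g != 1].
Proof.
move=> m3 [a [e fE]] [g0 fg0].
(* w is f or its inverse, conjugated by an initial segment k of that word. *)
have red (w : T -> T) (sg : bool) (k : T -> T) :
    (forall g, w g = (k g)^-1 * (if sg then f g else (f g)^-1) * k g) ->
    ((exists g, w g <> 1) -> tame [set g | w g <> 1]) -> tame [set g | f g != 1].
  move=> wE tw.
  have fw g : w g = 1 <-> f g = 1.
    rewrite wE; split=> [/mul1C|->]; last by rewrite invg1 if_same mulg1 mulVg.
    by rewrite mulVKg; case: sg {wE} => // /(congr1 (fun h : T => h^-1));
      rewrite invgK invg1.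
  apply: tame_sub (tw _) => [g /= wg|]; first by apply/eqP => /fw.
  by exists g0 => /fw; apply/eqP.
have pos b s (sg : bool) k : (forall g, pos_word (b :: s) g =
      (k g)^-1 * (if sg then f g else (f g)^-1) * k g) ->
    tame [set g | f g != 1].
  by move=> wE; apply: red wE _ => _; exact: tame_pos_word.
have mixed b1 b2 b3 (sg : bool) k : (forall g, g * b1 * g^-1 * b2 * g * b3 =
      (k g)^-1 * (if sg then f g else (f g)^-1) * k g) ->
    tame [set g | f g != 1].
  by move=> wE; apply: red wE _ => _; exact: tame_mixed.
have conj b1 b2 (sg : bool) k : (forall g, g^-1 * b1 * g * b2 =
      (k g)^-1 * (if sg then f g else (f g)^-1) * k g) ->
    tame [set g | f g != 1].
  by move=> wE; apply: red wE _; exact: tame_conj.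
pose groupE := (invgM, invgK, @invg1 T, mulgA, mulg1, mul1g, mulgV, mulVg,
  mulgK, mulgVK).
case: m m3 a e fE => [|[|[|[|//]]]] _ a e fE.
- by apply: tame_sub tame_setT => g _ /=; move: fg0; rewrite !fE !big_ord0.
- pose a0 := a ord0; pose a1 := a (lift ord0 ord0).
  by case e0: (e ord0);
    [ apply: (pos (a0^-1 * a1^-1) [::] false (fun=> a1^-1))
    | apply: (pos (a1 * a0) [::] true (fun=> a0)) ];
    move=> g; rewrite fE !big_ord_recl big_ord0 e0 /= !groupE.
- pose a0 := a ord0; pose a1 := a (lift ord0 ord0).
  pose a2 := a (lift ord0 (lift ord0 ord0)).
  by case e0: (e ord0); case e1: (e (lift ord0 ord0));
    [ apply: (pos a1^-1 [:: a0^-1 * a2^-1] false (fun=> a2^-1))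
    | apply: (conj a1 (a2 * a0) true (fun=> a0))
    | apply: (conj (a2 * a0) a1 true (fun g => a0 * g * a1))
    | apply: (pos a1 [:: a2 * a0] true (fun=> a0)) ];
    move=> g; rewrite fE !big_ord_recl big_ord0 e0 e1 /= !groupE.
pose a0 := a ord0; pose a1 := a (lift ord0 ord0).
pose a2 := a (lift ord0 (lift ord0 ord0)).
pose a3 := a (lift ord0 (lift ord0 (lift ord0 ord0))).
by case e0: (e ord0); case e1: (e (lift ord0 ord0));
  case e2: (e (lift ord0 (lift ord0 ord0)));
  [ apply: (pos a2^-1 [:: a1^-1; a0^-1 * a3^-1] false (fun=> a3^-1))
  | apply: (mixed (a0^-1 * a3^-1) a2^-1 a1^-1 false
      (fun g => a3^-1 * g^-1 * a2^-1 * g * a1^-1))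
  | apply: (mixed a2^-1 a1^-1 (a0^-1 * a3^-1) false (fun=> a3^-1))
  | apply: (mixed (a3 * a0) a1 a2 true (fun g => a0 * g^-1 * a1 * g * a2))
  | apply: (mixed a1^-1 (a0^-1 * a3^-1) a2^-1 false
      (fun g => a3^-1 * g * a2^-1))
  | apply: (mixed a1 a2 (a3 * a0) true (fun=> a0))
  | apply: (mixed a2 (a3 * a0) a1 true (fun g => a0 * g * a1))
  | apply: (pos a1 [:: a2; a3 * a0] true (fun=> a0)) ];
  move=> g; rewrite fE !big_ord_recl big_ord0 e0 e1 e2 /= !groupE.
Qed.

(** * Polynomials and pointwise convergence *)

(** Continuity for the topology of pointwise convergence, in terms of finite sets
of points. *)
Definition local (f : T -> T) := forall g y, exists F : seq X,
  forall h, {in F, act h =1 act g} -> act (f h) y = act (f g) y.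

Lemma local_eq (f1 f2 : T -> T) : f1 =1 f2 -> local f1 -> local f2.
Proof. by move=> /funext ->. Qed.

Lemma local_cst a : local (fun=> a).
Proof. by move=> g y; exists [::]. Qed.

Lemma localM (f1 f2 : T -> T) :
  local f1 -> local f2 -> local (fun g => f1 g * f2 g).
Proof.
move=> l1 l2 g y; have [F1 F1P] := l1 g y; have [F2 F2P] := l2 g (act (f1 g) y).
exists (F1 ++ F2) => h hg; rewrite !actM F1P ?F2P // => x xF;
  by apply: hg; rewrite mem_cat xF ?orbT.
Qed.

(** The value of the inverse at [y] is known as soon as the value at the preimage
of [y] is. *)
Lemma local_pow (s : bool) : local (fun g => if s then g^-1 else g).
Proof.
case: s => g y; last by exists [:: y] => h; apply; rewrite inE.
exists [:: act g^-1 y] => h /(_ _ (mem_head _ _)) hg.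
by apply: (@act_inj h); rewrite hg !actKV.
Qed.

Lemma poly_local m (f : T -> T) : group_polynomial m f -> local f.
Proof.
move=> [a [e fE]]; apply: (local_eq (fsym fE)); apply: localM (local_cst _) _.
elim: index_enum => [|i s IH].
  by apply: (local_eq _ (local_cst 1)) => g; rewrite big_nil.
apply: (local_eq _ (localM (localM (local_pow (e i)) (local_cst _)) IH)) => g.
by rewrite big_cons.
Qed.

(** The open sets of the topology of pointwise convergence; see
[pointwise_nearby]. *)
Definition nearby (U : set T) := forall g, U g -> exists F : seq X,
  forall h, {in F, act h =1 act g} -> U h.

Lemma zariski_base n (U : set (zariski n T)) g : open U -> U g ->
  exists L : seq (set T), {in L, forall V, zariski_subbase n V /\ V g} /\
    forall h, {in L, forall V : set T, V h} -> U h.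
Proof.
move=> [D DB <-] [B DB' Bg]; have [A AS BE] := DB _ DB'; rewrite -BE in Bg.
exists (finmap.enum_fset A); split=> [V VA|h hA].
  by split; [have := AS V VA; rewrite inE|exact: Bg].
exists B => //; suff: (B : set T) h by [].
by rewrite -BE => V /hA.
Qed.

Lemma zariski_nearby n (U : set (zariski n T)) : open U -> nearby U.
Proof.
move=> oU g Ug; have [L [LS LU]] := zariski_base oU Ug.
suff [F FP] : exists F : seq X, forall h, {in F, act h =1 act g} ->
    {in L, forall V : set T, V h} by exists F => h /FP/LU.
elim: L LS {LU} => [|V L IH] LS; first by exists [::].
have [|F FP] := IH; first by move=> W WL; apply: LS; rewrite inE WL orbT.
have [[m [f [_ pf VE]]] Vg] := LS V (mem_head _ _).
have [y fy] : exists y, act (f g) y <> y.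
  by apply: act_moves; apply/eqP; move: Vg; rewrite VE.
have [F' F'P] := poly_local pf g y.
exists (F' ++ F) => h hg W; rewrite inE => /predU1P[->|].
  rewrite VE /=; apply/eqP => /(congr1 (act^~ y)); rewrite F'P //.
  by move=> x xF; apply: hg; rewrite mem_cat xF.
by apply: FP => x xF; apply: hg; rewrite mem_cat xF orbT.
Qed.

(** Any topology for which the evaluation sets are neighbourhoods is finer than
the topology of pointwise convergence. *)
Lemma nearby_filter (Phi : set_system T) (U : set T) g : Filter Phi ->
  (forall x, Phi [set h | act h x = act g x]) -> nearby U -> U g -> Phi U.
Proof.
move=> PhiF evP nU /nU[F FU]; apply: filterS FU _.
elim: F => [|x F IH]; first by apply: filterS filterT => h _ x.
apply: filterS (filterI (evP x) IH) => h [hx hF] z; rewrite inE => /predU1P[->//|].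
exact: hF.
Qed.

Lemma pointwise_nearby (U : set T) : @open (pointwise G) U <-> nearby U.
Proof.
split=> [[A oA AU] g Ug|nU].
  pose Phi := filter_from [set: seq X]
    (fun F => [set k : X -> X | {in F, k =1 act g}]).
  have PhiF : Filter Phi.
    apply: filter_from_filter; first by exists [::].
    move=> F1 F2 _ _; exists (F1 ++ F2) => // k kg.
    by split=> x xF; apply: kg; rewrite mem_cat xF ?orbT.
  have cvg : {ptws, Phi --> (act g : X -> discrete_topology X)}.
    apply/cvg_sup => x B [_ [[C oC <-] Cx] CB].
    exists [:: x] => // k /(_ _ (mem_head _ _)) kx.
    by apply: CB; rewrite /preimage /= kx.
  have [|F _ FA] := cvg A.
    by apply: open_nbhs_nbhs; split=> //; rewrite -AU in Ug.
  by exists F => h /FA; rewrite -AU.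
rewrite openE => g Ug; apply: (@nearby_filter (nbhs (g : pointwise G)) U g) => // x.
apply: open_nbhs_nbhs; split=> //.
exists (proj x @^-1` [set act g x]) => //.
apply: open_comp; last exact: discrete_open.
by move=> k _; exact: (@proj_continuous _ (fun=> discrete_topology X)).
Qed.

(** * The dichotomy *)

Lemma hyperconnected_zariski n : (n <= 3)%N -> hyperconnected (zariski n T).
Proof.
move=> n3 U V oU oV [g Ug] [h Vh].
have [LU [LUS LUU]] := zariski_base oU Ug.
have [LV [LVS LVV]] := zariski_base oV Vh.
have tameS W k : zariski_subbase n W -> W k -> tame W.
  move=> [m [f [mn pf ->]]] fk; apply: cubic_tame pf _; last by exists k.
  exact: leq_trans n3.
have [k kL] : exists k, {in LU ++ LV, forall W : set T, W k}.
  apply: tame_meet => W; rewrite mem_cat => /orP[/LUS|/LVS] [WS];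
    exact: tameS.
by exists k; split; [apply: LUU | apply: LVV] => W WL; apply: kL;
  rewrite mem_cat WL ?orbT.
Qed.

Lemma zariski_subbase_open n (V : set (zariski n T)) :
  zariski_subbase n V -> open V.
Proof.
move=> SV; exists [set V]; last by rewrite bigcup_set1.
move=> _ ->; exists (finmap.fset1 (V : set T)).
  by move=> W; rewrite finmap.inE => /eqP ->; rewrite inE.
by rewrite set_fset1 bigcap_set1.
Qed.

(** The commutator of (x t) and (u v)^g is a word of degree 4 in [g].  As the two
transpositions are involutions, it is the square of their product. *)
Lemma commutator_open n u v x t : (4 <= n)%N ->
  open ([set g | tr x t * tr (act g u) (act g v) <>
                 tr (act g u) (act g v) * tr x t] : set (zariski n T)).
Proof.
move=> n4.
pose f g := tr x t * g^-1 * tr u v * g * tr x t * g^-1 * tr u v * g.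
have fE g : f g = tr x t * tr (act g u) (act g v) * (tr x t * tr (act g u) (act g v)).
  by rewrite /f -tr_conj !mulgA.
have pf : group_polynomial 4 f.
  exists (fun i : 'I_5 => nth 1 [:: tr x t; tr u v; tr x t; tr u v; 1] i).
  exists (fun i : 'I_4 => ~~ odd i) => g.
  by rewrite !big_ord_recl big_ord0 /= /f !mulgA !mulg1.
rewrite (_ : mkset _ = [set g | f g != 1]).
  by apply: zariski_subbase_open; exists 4, f.
have sqE a b : a * a = 1 -> b * b = 1 -> a * b * (a * b) = 1 <-> a * b = b * a.
  move=> /mulg1_eq aa /mulg1_eq bb; split=> [/mulg1_eq|{1}->].
    by rewrite invgM aa bb.
  by rewrite -{1}aa -{1}bb -invgM mulVg.
by apply/seteqP; split=> g /= tg; [apply/eqP | move/eqP: tg];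
  rewrite fE sqE ?tr_sqr.
Qed.

(** Disjoint transpositions commute, so the commutator condition for [t] puts
[act g u] or [t] in the pair {act h u, act h v}, which has no room for three
different values of [t]. *)
Lemma nbhs_meet n g u v : (4 <= n)%N -> u != v ->
  nbhs (g : zariski n T) [set h | act g u \in [:: act h u; act h v]].
Proof.
move=> n4 uv; set x := act g u.
have [t1 t1P] := fresh [:: x; act g v].
have [t2] := fresh [:: t1; x; act g v]; rewrite inE negb_or => /andP[t21 t2P].
have [t3] := fresh [:: t1; t2; x; act g v].
rewrite 2!inE 2!negb_or => /and3P[t31 t32 t3P].
have nbhs_t t : t \notin [:: x; act g v] -> nbhs (g : zariski n T)
    [set h | (x \in [:: act h u; act h v]) || (t \in [:: act h u; act h v])].
  rewrite !inE negb_or => /andP[tx tgv].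
  have tg : tr x t * tr (act g u) (act g v) <> tr (act g u) (act g v) * tr x t.
    apply: tr_meet; first by rewrite eq_sym.
    by rewrite !inE negb_or eq_sym (inj_eq (@act_inj g)) uv eq_sym.
  have := open_nbhs_nbhs (conj (commutator_open u v x t n4) tg).
  apply: filterS => h /= xt; apply: contra_notT xt.
  rewrite !inE !negb_or => /andP[/andP[xu xv] /andP[tu tv]].
  by apply: tr_disjoint; rewrite !inE negb_or ![act h _ == _]eq_sym ?xu ?xv.
apply: filterS3 (nbhs_t _ t1P) (nbhs_t _ t2P) (nbhs_t _ t3P) => h /=.
case: (act g u \in _) => //=; rewrite !inE.
by move=> /pred2P[] e1 /pred2P[] e2 /pred2P[] e3;
  move: t21 t31 t32; rewrite e1 e2 e3 eqxx.
Qed.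

(** The pairs {u, v1} and {u, v2} have only [u] in common. *)
Lemma eval_open n u x : (4 <= n)%N ->
  open ([set h | act h u = x] : set (zariski n T)).
Proof.
move=> n4; rewrite openE => g /= <-.
have [v1] := fresh [:: u]; have [v2] := fresh [:: u; v1].
rewrite !inE => /norP[v2u v21] v1u.
have uv1 : u != v1 by rewrite eq_sym.
have uv2 : u != v2 by rewrite eq_sym.
apply: filterS (filterI (nbhs_meet g n4 uv1) (nbhs_meet g n4 uv2)) => h [] /=.
rewrite !inE => /orP[/eqP-> //|/eqP ->]; rewrite !(inj_eq (@act_inj h)).
by rewrite eq_sym (negPf uv1) /= eq_sym (negPf v21).
Qed.

Lemma zariski_openP n (U : set (zariski n T)) : (4 <= n)%N ->
  open U <-> nearby U.
Proof.
move=> n4; split=> [|nU]; first exact: zariski_nearby.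
rewrite openE => g Ug.
apply: (@nearby_filter (nbhs (g : zariski n T)) U g) => // x.
by apply: open_nbhs_nbhs; split=> //; exact: eval_open.
Qed.

Lemma totally_disconnected_zariski n : (4 <= n)%N ->
  totally_disconnected [set: zariski n T].
Proof.
move=> n4; apply: zero_dimension_totally_disconnected => g h gh.
have [x ghx] : exists x, act g x <> act h x.
  by apply/existsNP => gh1; move/eqP: gh; apply; exact: act_ext.
exists [set k : zariski n T | act k x = act g x].
split=> //; last by move=> /= hg; apply: ghx.
split; first exact: eval_open.
rewrite -openC; apply/zariski_openP => // k kx; exists [:: x] => l lk.
by rewrite /= lk ?mem_head.
Qed.

End PermutationGroup.

Theorem corollary1p15 (X : choiceType) (G : groupClosed (Sym X)) (n : nat) :
  infinite_set [set: X] ->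
  (Sym_fin X `<=` [set s | s \in (G : {pred Sym X})]) ->
  ((4 <= n)%N ->
     open_sets (zariski n (subgroup G)) = open_sets (pointwise G)
       :> set (set (subgroup G)) /\
     totally_disconnected [set: zariski n (subgroup G)]) /\
  ((n <= 3)%N -> hyperconnected (zariski n (subgroup G))).
Proof.
move=> infX finG; split=> [n4|n3]; last exact: hyperconnected_zariski.
split; last exact: totally_disconnected_zariski.
apply/funext => U; apply/propext.
exact: iff_trans (zariski_openP infX finG U n4) (iff_sym (pointwise_nearby U)).
Qed.
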